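(* Let $f:\mathbb{R}^d\to\mathbb{R}$ be $\mu$-strongly convex ($\mu>0$) and $L$-smooth ($0<L<\infty$), with minimum $f^*$. Let $\{x_k\}_{k\in\mathbb{N}}$ be generated by $x_{k+1}=x_k-\eta_k\, g(x_k;\xi_k)$, $k\in\mathbb{N}$, from $x_0\in\mathbb{R}^d$, where for all $k\in\mathbb{N}$, $$\mathbb{E}\left[g(x_k;\xi_k)\mid\mathcal{F}_k\right]=\nabla f(x_k)\quad\text{and}\quad \mathbb{E}\left[\exp\left(t\|g(x_k;\xi_k)-\nabla f(x_k)\|^2\right)\mid\mathcal{F}_k\right]\le\frac{1}{\sqrt{1-2t}}\quad\forall t\in\left(0,\tfrac12\right).$$ For $k\in\mathbb{N}$ set $$\eta_k=\frac{4}{\mu(k+B)},\qquad t_k=\frac{\mu(k+B-1)}{16},\qquad\text{where } B:=\max\left\{\frac{4L}{\mu},3\right\}.$$ Let $\Delta_0:=f(x_0)-f^*$. Then for any $k\in\mathbb{N}$ and any $\beta\in(0,1)$, $$\mathbb{P}\left(f(x_k)-f^*\le\frac{16\mu\log(1/\beta)+\mu^2(B-1)\Delta_0+16L}{\mu^2(k+B-1)}\right)\ge1-\beta.$$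
   Context: $\mathbb{N}=\{0,1,2,\dots\}$. $L$-smoothness of $f$ means that $f$ is differentiable and $\|\nabla f(x)-\nabla f(y)\|\le L\|x-y\|$ for all $x,y\in\mathbb{R}^d$. The starting point $x_0\in\mathbb{R}^d$ is deterministic. $\xi_0,\xi_1,\dots$ are the random elements driving the stochastic gradients $g(x_k;\xi_k)\in\mathbb{R}^d$; $\mathcal{F}_k=\sigma(\xi_0,\dots,\xi_{k-1})$ for $k\ge1$ and $\mathcal{F}_0$ is the trivial $\sigma$-algebra. $\log$ is the natural logarithm and $\|\cdot\|$ the Euclidean norm. *)

(* Defs.v *)
From mathcomp Require Import all_boot all_order all_algebra.
From mathcomp Require Import all_classical all_reals all_analysis.
Import Order.TTheory GRing.Theory Num.Theory.
Import numFieldNormedType.Exports.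

Set Implicit Arguments.
Unset Strict Implicit.
Unset Printing Implicit Defensive.

Local Open Scope classical_set_scope.
Local Open Scope ring_scope.

(* The library's norm on 'rV[R]_d is the max norm, hence a separate Euclidean
   norm. Both induce the same topology, so [differentiable] below has its usual
   meaning. *)
Definition enorm (R : realType) (d : nat) (v : 'rV[R]_d) : R :=
  Num.sqrt (\sum_(i < d) v ord0 i ^+ 2).

Definition gradient (R : realType) (d : nat) (f : 'rV[R]_d -> R)
    (x : 'rV[R]_d) : 'rV[R]_d :=
  \row_(i < d) 'D_('e_i) f x.

Definition smooth (R : realType) (d : nat) (L : R) (f : 'rV[R]_d -> R) : Prop :=
  (forall x, differentiable f x) /\
  (forall x y, enorm (gradient f x - gradient f y) <= L * enorm (x - y)).

Definition strongly_convex (R : realType) (d : nat) (mu : R)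
    (f : 'rV[R]_d -> R) : Prop :=
  forall (x y : 'rV[R]_d) (a : R), 0 <= a <= 1 ->
    f (a *: x + (1 - a) *: y) <=
      a * f x + (1 - a) * f y - mu / 2 * a * (1 - a) * enorm (x - y) ^+ 2.

(* sigma(xi_0, ..., xi_{k-1}); for k = 0 the generating family is empty and
   this is the trivial sigma-algebra. *)
Definition history (dT dX : measure_display) (T : measurableType dT)
    (X : measurableType dX) (xi : nat -> T -> X) (k : nat) : set (set T) :=
  <<s \bigcup_(i in `I_k) preimage_set_system setT (xi i) measurable >>.

Definition measurable_wrt (R : realType) (T : Type) (G : set (set T))
    (Y : T -> R) : Prop :=
  forall B : set R, measurable B -> G (Y @^-1` B).

(* Y is a version of E[Z | G], for Z integrable and G a sub-sigma-algebra. *)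
Definition is_condexp (R : realType) (dT : measure_display)
    (T : measurableType dT) (P : probability T R) (G : set (set T))
    (Z Y : T -> R) : Prop :=
  [/\ P.-integrable setT (EFin \o Z),
      P.-integrable setT (EFin \o Y),
      measurable_wrt G Y &
      forall A : set T, G A ->
        (\int[P]_(w in A) (Y w)%:E = \int[P]_(w in A) (Z w)%:E)%E].

(* E[Z | G] = W almost surely. *)
Definition condexp_eq (R : realType) (dT : measure_display)
    (T : measurableType dT) (P : probability T R) (G : set (set T))
    (Z W : T -> R) : Prop :=
  exists2 Y : T -> R, is_condexp P G Z Y & {ae P, forall w, Y w = W w}.

(* E[Z | G] <= c almost surely. For Z >= 0 the integrability of Z required by
   [is_condexp] is no restriction: the finite bound c forces E[Z] <= c. *)
Definition condexp_le (R : realType) (dT : measure_display)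
    (T : measurableType dT) (P : probability T R) (G : set (set T))
    (Z : T -> R) (c : R) : Prop :=
  exists2 Y : T -> R, is_condexp P G Z Y & {ae P, forall w, Y w <= c}.

(* Main.v *)
(* Write [D_k = f(x_k) - f*], [s] for the squared gradient norm at [x_k], [r] for
   the squared norm of the noise, [p] for the inner product of gradient and noise,
   and [c = L * eta_k <= 1]. As [t_{k+1} * eta_k = 1/4], the descent lemma bounds
   [t_{k+1} D_{k+1}] by [t_{k+1} D_k] plus the convex combination
   [(1 - c)(-s/4 - p/4) + c(-s/8 + r/8)], so convexity of exp separates the linear
   noise term from the quadratic one. For small gradients [exp(x) <= x + exp(x^2)]
   makes the linear term centered; for large ones AM-GM suffices. Only the moment
   hypothesis at [t = 1/4] is used, and always through a bound that is affine in
   [exp(r/4)], so conditioning reduces to multiplying by F_k-measurable weights: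
     [E exp(t_{k+1} D_{k+1}) <= E exp(c/4 - s/16 + t_{k+1} D_k)].
   The Polyak-Lojasiewicz inequality turns the exponent into
   [c/4 + rho t_k D_k] with [rho = 1 - 1/(k+B-1) < 1]; convexity of exp then gives
   [E exp(t_k D_k) <= exp(t_0 D_0 + L/mu)] for all [k], and Markov concludes. *)
Require Import Defs.
From mathcomp Require Import all_boot all_order all_algebra.
From mathcomp Require Import all_classical all_reals all_analysis.
From mathcomp Require Import measurable_realfun ring lra.
Import Order.TTheory GRing.Theory Num.Theory.
Import numFieldNormedType.Exports.

Set Implicit Arguments.
Unset Strict Implicit.
Unset Printing Implicit Defensive.

Local Open Scope classical_set_scope.
Local Open Scope ring_scope.

(** * Exponential bounds for one descent step *)

(** Take the tangent-line bounds at the mean [m] with weights [a] and [1 - a]: the first-order terms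
    cancel. *)
Lemma expR_convex (R : realType) (a x y : R) : 0 <= a <= 1 ->
  expR (a * x + (1 - a) * y) <= a * expR x + (1 - a) * expR y.
Proof.
move=> /andP[a0 a1].
set m := a * x + (1 - a) * y.
have tangent z : expR m * (1 + (z - m)) <= expR z.
  have -> : expR z = expR m * expR (z - m) by rewrite -expRD subrKC.
  by rewrite ler_wpM2l ?expR_ge0// expR_ge1Dx.
have := lerD (ler_wpM2l a0 (tangent x))
  (ler_wpM2l (_ : 0 <= 1 - a) (tangent y)).
rewrite subr_ge0 => /(_ a1); apply: le_trans.
by rewrite /m le_eqVlt; apply/orP; left; apply/eqP; ring.
Qed.

Lemma expR_mul1B (R : realType) (x : R) : expR x * (1 - x) <= 1.
Proof.
have := expR_ge1Dx (- x); rewrite -(ler_pM2l (expR_gt0 x)).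
by rewrite -expRD subrr expR0.
Qed.

(** For [1 <= x], monotonicity and [x <= x ^+ 2] suffice. Below 1, [expR_mul1B] bounds [expR x]
    above by a rational function and [expR (x ^+ 2)] is bounded below by a polynomial, which leaves
    a polynomial inequality. *)
Lemma expR_le_addr_sqr (R : realType) (x : R) : expR x <= x + expR (x ^+ 2).
Proof.
have sq_ge (z : R) : 0 <= z -> 1 + z + z ^+ 2 / 3 <= expR z.
  move=> z0; have -> : expR z = expR (z / 3) ^+ 3.
    by rewrite -expRM_natl; congr expR; field.
  apply: (@le_trans _ _ ((1 + z / 3) ^+ 3)); last first.
    by rewrite lerXn2r ?nnegrE ?expR_ge0 ?expR_ge1Dx//; lra.
  have : 0 <= z ^+ 3 by rewrite exprn_ge0.
  by rewrite -subr_ge0; nra.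
have [x1|x1] := leP 1 x.
  rewrite (@le_trans _ _ (expR (x ^+ 2)))// ?lerDr; last by lra.
  by rewrite ler_expR; nra.
have [x0|x0] := leP x 0.
  (* The right-hand side equals [1 - x ^+ 3], which is at least 1 for [x <= 0]. *)
  suff : expR x * (1 - x) <= (x + (1 + x ^+ 2)) * (1 - x).
    rewrite ler_pM2r ?subr_gt0// => /le_trans; apply.
    by rewrite lerD2l expR_ge1Dx.
  by apply: (le_trans (expR_mul1B x)); nra.
(* On [(0, 1)] the bound [1 / (1 - x)] is too weak near 1; applied to a quarter of the argument it
   gives [expR x * (1 - y) ^+ 4 <= 1]. *)
set y := x / 4; have xE : x = 4 * y by rewrite /y; field.
have y0 : 0 < y by lra.
have y1 : y < 1 / 4 by lra.
have q4 : 3 / 10 <= (1 - y) ^+ 4.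
  have : 9 / 16 <= (1 - y) ^+ 2 by nra.
  by rewrite (exprM _ 2 2); nra.
suff : expR x * (1 - y) ^+ 4 <=
    (x + (1 + x ^+ 2 + (x ^+ 2) ^+ 2 / 3)) * (1 - y) ^+ 4.
  rewrite ler_pM2r ?exprn_gt0//; last by lra.
  by move=> /le_trans; apply; rewrite lerD2l sq_ge// sqr_ge0.
apply: (@le_trans _ _ 1).
  have -> : expR x = expR y ^+ 4 by rewrite xE -expRM_natl.
  by rewrite -exprMn exprn_ile1 ?expR_mul1B// mulr_ge0 ?expR_ge0//; lra.
rewrite xE -subr_ge0.
have -> : (4 * y + (1 + (4 * y) ^+ 2 + ((4 * y) ^+ 2) ^+ 2 / 3)) * (1 - y) ^+ 4 - 1
    = y ^+ 2 * (6 - 44 * y + 81 * y ^+ 2 - 60 * y ^+ 3 + 16 * y ^+ 4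
                + 256 / 3 * y ^+ 2 * (1 - y) ^+ 4) by field.
rewrite mulr_ge0 ?sqr_ge0//.
(* These bounds reduce the bracket to [6 - 44 y + (81 - 15 + 25.6) y^2], of negative discriminant:
   15 comes from the cubic term with [y <= 1 / 4], 25.6 from [q4]. *)
have : 0 <= y ^+ 4 by rewrite exprn_ge0// ltW.
have : y ^+ 3 <= y ^+ 2 / 4 by rewrite exprS; nra.
have : 0 <= y ^+ 2 by rewrite sqr_ge0.
have : y ^+ 2 * (3 / 10) <= y ^+ 2 * (1 - y) ^+ 4 by rewrite ler_wpM2l// sqr_ge0.
set u := y ^+ 2 * (1 - y) ^+ 4; set a := y ^+ 4; set b := y ^+ 3; move: u a b.
move=> u a b; nra.
Qed.

(* With [s] the squared gradient norm and [c = L * eta_k], the three functions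
   below are the coefficients of an affine bound, in terms of the noise, on the
   exponential of one descent step; the threshold [s <= 4] separates the
   gradients for which [expR_le_addr_sqr] pays off from the ones for which AM-GM
   is enough. *)
Definition step_cst (R : realType) (c s : R) : R :=
  (1 - c) * expR (- s / 4) * (if s <= 4 then 1 - s / 4 else 0)
  + c * expR (- s / 8) / 2.

Definition step_exp (R : realType) (c s : R) : R :=
  (1 - c) * expR (- s / 4) * (if s <= 4 then s / 4 else expR (s / 16))
  + c * expR (- s / 8) / 2.

Definition step_lin (R : realType) (c s : R) : R :=
  if s <= 4 then - (1 - c) * expR (- s / 4) / 4 else 0.

Lemma step_cst_ge0 (R : realType) (c s : R) : 0 <= c <= 1 -> 0 <= s ->
  0 <= step_cst c s.
Proof.
move=> /andP[c0 c1] s0; rewrite /step_cst addr_ge0//.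
  by rewrite !mulr_ge0 ?expR_ge0 ?subr_ge0//; case: ifPn => //; lra.
by rewrite !mulr_ge0 ?expR_ge0.
Qed.

Lemma step_exp_ge0 (R : realType) (c s : R) : 0 <= c <= 1 -> 0 <= s ->
  0 <= step_exp c s.
Proof.
move=> /andP[c0 c1] s0; rewrite /step_exp addr_ge0//.
  rewrite !mulr_ge0 ?expR_ge0 ?subr_ge0//.
  by case: ifPn => // _; rewrite ?expR_ge0// divr_ge0.
by rewrite !mulr_ge0 ?expR_ge0.
Qed.

(** Here [3 / 2] is the bound on the conditional mean of [expR (r / 4)]. In [main], the bracket is
    [1 + s / 8] for [s <= 4]; for [s > 4] it is [3 / 2 * expR (s / 16)], where
    [3 / 2 <= expR (s / 8)]. Both are at most [expR (3 * s / 16)]. *)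
Lemma step_sum_le (R : realType) (c s : R) : 0 <= c <= 1 -> 0 <= s ->
  step_cst c s + 3 / 2 * step_exp c s <= expR (c / 4 - s / 16).
Proof.
move=> /andP[c0 c1] s0.
have main : expR (- s / 4) * ((if s <= 4 then 1 - s / 4 else 0)
      + 3 / 2 * (if s <= 4 then s / 4 else expR (s / 16))) <= expR (- s / 16).
  have -> : expR (- s / 16) = expR (- s / 4) * expR (3 * s / 16).
    by rewrite -expRD; congr expR; field.
  rewrite ler_wpM2l ?expR_ge0//; case: ifPn => [s4|].
    by apply: le_trans (expR_ge1Dx _); lra.
  rewrite -ltNge => s4; rewrite add0r.
  have -> : 3 * s / 16 = s / 8 + s / 16 by field.
  rewrite expRD ler_wpM2r ?expR_ge0//.
  by apply: le_trans (expR_ge1Dx _); lra.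
have rest : expR (- s / 8) <= expR (- s / 16) by rewrite ler_expR; lra.
have -> : expR (c / 4 - s / 16) = expR (- s / 16) * expR (c / 4).
  by rewrite -expRD; congr expR; field.
(* The quadratic part has weight [1 / 2 + 3 / 2 * 1 / 2 = 5 / 4], and
   [(1 - c) + c * 5 / 4 = 1 + c / 4]. *)
apply: (@le_trans _ _ (expR (- s / 16) * (1 + c / 4))); last first.
  by rewrite ler_wpM2l ?expR_ge0// expR_ge1Dx.
have := lerD (ler_wpM2l (_ : 0 <= 1 - c) main)
  (ler_wpM2l (_ : 0 <= c * (5 / 4)) rest).
have -> // : 0 <= 1 - c by lra.
have -> // : 0 <= c * (5 / 4) by lra.
move=> /(_ isT isT) h; rewrite /step_cst /step_exp.
by move: h; case: ifPn => _ h; lra.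
Qed.

(* [p] is the inner product of the gradient with the noise and [r] the squared
   norm of the noise. *)
Lemma expR_step_le (R : realType) (c s p r : R) : 0 <= c <= 1 ->
  0 <= s -> 0 <= r -> p ^+ 2 <= s * r ->
  expR ((1 - c) * (- s / 4 - p / 4) + c * (- s / 8 + r / 8)) <=
    step_cst c s + step_exp c s * expR (r / 4) + step_lin c s * p.
Proof.
move=> /andP[c0 c1] s0 r0 psr.
have half : expR (r / 8) <= (1 + expR (r / 4)) / 2.
  have h : 0 <= (2^-1 : R) <= 1 by lra.
  have := expR_convex 0 (r / 4) h; rewrite expR0.
  have -> : 2^-1 * 0 + (1 - 2^-1) * (r / 4) = r / 8 by field.
  by move=> /le_trans; apply; lra.
have lin : expR (- p / 4) <= (if s <= 4 then 1 - s / 4 else 0)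
    + (if s <= 4 then s / 4 else expR (s / 16)) * expR (r / 4)
    + (if s <= 4 then - p / 4 else 0).
  case: ifPn => [s4|].
    (* The squared exponent is at most [(s / 4) * (r / 4)]; as [s / 4 <= 1] is a convex weight, its
       exponential is at most the chord between [expR 0] and [expR (r / 4)]. *)
    apply: (le_trans (expR_le_addr_sqr _)); rewrite addrC lerD2r.
    have h : 0 <= s / 4 <= 1 by lra.
    have := expR_convex (r / 4) 0 h; rewrite expR0.
    rewrite mulr0 addr0 mulr1 addrC; apply: le_trans.
    rewrite ler_expR; nra.
  rewrite -ltNge => s4; rewrite add0r addr0 -expRD ler_expR.
  have sr0 : 0 <= s / 4 + r by lra.
  (* AM-GM: [s * r <= (s / 4 + r) ^+ 2]. *)
  have : `|p| <= s / 4 + r.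
    rewrite -(@ler_pXn2r _ 2)// ?nnegrE// real_normK ?num_real//.
    by apply: (le_trans psr); have := sqr_ge0 (s / 4 - r); nra.
  by rewrite ler_norml => /andP[] *; lra.
have c'01 : 0 <= 1 - c <= 1 by lra.
have := expR_convex (- s / 4 - p / 4) (- s / 8 + r / 8) c'01.
rewrite opprB subrKC => /le_trans; apply.
have -> : expR (- s / 4 - p / 4) = expR (- s / 4) * expR (- p / 4).
  by rewrite -expRD; congr expR; field.
rewrite expRD.
have := lerD (ler_wpM2l (_ : 0 <= (1 - c) * expR (- s / 4)) lin)
  (ler_wpM2l (_ : 0 <= c * expR (- s / 8)) half).
rewrite !mulr_ge0 ?expR_ge0 ?subr_ge0// => /(_ isT isT); rewrite -!mulrA.
move=> /le_trans; apply.
rewrite /step_cst /step_exp /step_lin.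
by case: ifPn => _; rewrite le_eqVlt; apply/orP; left; apply/eqP; field.
Qed.

(** * Smooth and strongly convex functions *)

Definition dotr (R : realType) (d : nat) (u v : 'rV[R]_d) : R :=
  \sum_(i < d) u ord0 i * v ord0 i.

Lemma enorm_ge0 (R : realType) (d : nat) (v : 'rV[R]_d) : 0 <= enorm v.
Proof. exact: sqrtr_ge0. Qed.

Lemma enorm_sqr (R : realType) (d : nat) (v : 'rV[R]_d) :
  enorm v ^+ 2 = dotr v v.
Proof.
rewrite /enorm sqr_sqrtr; last by apply: sumr_ge0 => i _; exact: sqr_ge0.
by apply: eq_bigr => i _; rewrite expr2.
Qed.

Lemma enorm_sum_sqr (R : realType) (d : nat) (v : 'rV[R]_d) :
  enorm v ^+ 2 = \sum_(i < d) v ord0 i ^+ 2.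
Proof. by rewrite enorm_sqr; apply: eq_bigr => i _; rewrite expr2. Qed.

Lemma dotrDl (R : realType) (d : nat) (u v w : 'rV[R]_d) :
  dotr (u + v) w = dotr u w + dotr v w.
Proof. by rewrite -big_split; apply: eq_bigr => i _; rewrite mxE mulrDl. Qed.

Lemma dotrZl (R : realType) (d : nat) (a : R) (u v : 'rV[R]_d) :
  dotr (a *: u) v = a * dotr u v.
Proof. by rewrite /dotr mulr_sumr; apply: eq_bigr => i _; rewrite mxE mulrA. Qed.

Lemma dotrC (R : realType) (d : nat) (u v : 'rV[R]_d) : dotr u v = dotr v u.
Proof. by apply: eq_bigr => i _; rewrite mulrC. Qed.

Lemma dotrDr (R : realType) (d : nat) (u v w : 'rV[R]_d) :
  dotr w (u + v) = dotr w u + dotr w v.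
Proof. by rewrite dotrC dotrDl !(dotrC w). Qed.

Lemma dotrZr (R : realType) (d : nat) (a : R) (u v : 'rV[R]_d) :
  dotr u (a *: v) = a * dotr u v.
Proof. by rewrite dotrC dotrZl dotrC. Qed.

Lemma enormZ_sqr (R : realType) (d : nat) (a : R) (u : 'rV[R]_d) :
  enorm (a *: u) ^+ 2 = a ^+ 2 * enorm u ^+ 2.
Proof. by rewrite !enorm_sqr dotrZl dotrZr mulrA expr2. Qed.

Lemma enormD_sqr (R : realType) (d : nat) (u v : 'rV[R]_d) :
  enorm (u + v) ^+ 2 = enorm u ^+ 2 + 2 * dotr u v + enorm v ^+ 2.
Proof. by rewrite !enorm_sqr dotrDl !dotrDr (dotrC v u); ring. Qed.

(** Cauchy-Schwarz: the squared norm of [a *: v - p *: u] is [a * (a * b - p ^+ 2)], and [a > 0] can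
    be divided out; [a = 0] forces [u = 0]. *)
Lemma dotr_sqr_le (R : realType) (d : nat) (u v : 'rV[R]_d) :
  dotr u v ^+ 2 <= enorm u ^+ 2 * enorm v ^+ 2.
Proof.
set a := enorm u ^+ 2; set b := enorm v ^+ 2; set p := dotr u v.
have a0 : 0 <= a by exact: sqr_ge0.
have [a_eq0|aN0] := eqVneq a 0.
  have u0 i : u ord0 i = 0.
    have : a == 0 by apply/eqP.
    rewrite /a enorm_sum_sqr psumr_eq0; last by move=> j _; exact: sqr_ge0.
    by move=> /allP/(_ i); rewrite mem_index_enum sqrf_eq0 => /(_ isT)/eqP.
  by rewrite a_eq0 mul0r /p /dotr big1 ?expr0n// => i _; rewrite u0 mul0r.
have a_gt0 : 0 < a by rewrite lt_def aN0.
have := sqr_ge0 (enorm (a *: v + (- p) *: u)).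
rewrite enormD_sqr !enormZ_sqr dotrZl dotrZr (dotrC v u) -/a -/b -/p.
have -> : a ^+ 2 * b + 2 * (a * (- p * p)) + (- p) ^+ 2 * a = a * (a * b - p ^+ 2).
  by ring.
by rewrite pmulr_rge0// subr_ge0.
Qed.

Lemma dotr_le_enorm (R : realType) (d : nat) (u v : 'rV[R]_d) :
  dotr u v <= enorm u * enorm v.
Proof.
apply: le_trans (ler_norm _) _.
rewrite -(@ler_pXn2r _ 2)// ?nnegrE ?mulr_ge0 ?enorm_ge0//.
by rewrite real_normK ?num_real// exprMn dotr_sqr_le.
Qed.

Lemma derive_gradient (R : realType) (d : nat) (f : 'rV[R]_d -> R)
    (x h : 'rV[R]_d) : differentiable f x ->
  'D_h f x = dotr (gradient f x) h.
Proof.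
move=> fx; rewrite deriveE// {1}(row_sum_delta h) linear_sum.
by apply: eq_bigr => i _; rewrite linearZ /= mxE deriveE// mulrC.
Qed.

Lemma is_derive_line (R : realType) (d : nat) (f : 'rV[R]_d -> R)
    (x h : 'rV[R]_d) (s : R) : differentiable f (x + s *: h) ->
  is_derive s 1 (fun r : R => f (x + r *: h)) (dotr (gradient f (x + s *: h)) h).
Proof.
move=> fx; rewrite -derive_gradient//.
have quotE : (fun r : R => r^-1 *: (f (x + (r *: 1 + s) *: h) - f (x + s *: h))) =
    (fun r : R => r^-1 *: (f (r *: h + (x + s *: h)) - f (x + s *: h))).
  apply/funext => r; congr (_ *: (f _ - _)).
  by rewrite [r *: 1]mulr1 scalerDl addrCA.
have D : derivable f (x + s *: h) h by exact: diff_derivable.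
apply: DeriveDef; first by rewrite /derivable /= quotE.
by rewrite /derive /= quotE.
Qed.

(** Subtract the claimed quadratic bound along the segment to get [psi]. By the mean value theorem
    its increment is [dpsi c] at some [c] in [(0, 1)], and Cauchy-Schwarz with the Lipschitz
    gradient makes that nonpositive. *)
Lemma smooth_descent (R : realType) (d : nat) (L : R) (f : 'rV[R]_d -> R)
    (x h : 'rV[R]_d) : smooth L f ->
  f (x + h) <= f x + dotr (gradient f x) h + L / 2 * enorm h ^+ 2.
Proof.
move=> [df lip].
pose psi s := f (x + s *: h) - s * dotr (gradient f x) h
              - s ^+ 2 * (L / 2 * enorm h ^+ 2).
pose dpsi s := dotr (gradient f (x + s *: h)) h - dotr (gradient f x) h
              - 2 * s * (L / 2 * enorm h ^+ 2).
have dpsiE (s : R) : is_derive s 1 psi (dpsi s).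
  have := @is_derive_line _ _ _ x h s (df _) => df1.
  rewrite /psi; apply: is_derive_eq.
  by rewrite /dpsi /GRing.scale /=; ring.
have [|c c01] := @MVT R psi dpsi 0 1 ltr01 (fun s _ => dpsiE s).
  by apply: derivable_within_continuous => s _; have [] := dpsiE s.
rewrite subr0 mulr1 /psi !scale0r addr0 scale1r => E.
suff : dpsi c <= 0 by lra.
rewrite in_itv /= in c01; case/andP: c01 => c0 c1.
have := dotr_le_enorm (gradient f (x + c *: h) - gradient f x) h.
rewrite dotrDl -scaleN1r dotrZl mulN1r => le1.
have := lip (x + c *: h) x; rewrite [x + _ - x]addrAC subrr add0r.
have -> : enorm (c *: h) = c * enorm h.
  apply/eqP; rewrite -(@eqrXn2 _ 2)// ?mulr_ge0 ?enorm_ge0 ?ltW//.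
  by rewrite enormZ_sqr exprMn.
rewrite -scaleN1r => le2.
have le3 := ler_wpM2r (enorm_ge0 h) le2.
by rewrite /dpsi; nra.
Qed.

(** Divide the convexity inequality at [a *: y + (1 - a) *: x] by [a] and let [a] tend to 0 from the
    right. *)
Lemma strongly_convex_tangent (R : realType) (d : nat) (mu : R)
    (f : 'rV[R]_d -> R) (x y : 'rV[R]_d) :
  strongly_convex mu f -> differentiable f x ->
  f x + dotr (gradient f x) (y - x) + mu / 2 * enorm (y - x) ^+ 2 <= f y.
Proof.
move=> cf df; rewrite -derive_gradient//.
set N := enorm (y - x) ^+ 2.
have D : derivable f x (y - x) by exact: diff_derivable.
have lim1 : a^-1 *: (f (a *: (y - x) + x) - f x) @[a --> 0^'+] --> 'D_(y - x) f x.
  exact: cvg_dnbhs_at_right D.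
have lim2 : f y - f x - mu / 2 * (1 - a) * N @[a --> (0 : R)^'+] -->
     f y - f x - mu / 2 * (1 - 0) * N.
  apply: cvg_at_right_filter; apply: cvgB; first exact: cvg_cst.
  apply: cvgMl; apply: cvgMr; apply: cvgB; [exact: cvg_cst|exact: cvg_id].
suff : 'D_(y - x) f x <= f y - f x - mu / 2 * (1 - 0) * N by lra.
apply: ler_cvg_to lim1 lim2 _.
near=> a.
have a0 : 0 < a by [].
have a1 : a <= 1.
  by near: a; apply: nbhs_right_le.
have := cf y x a; rewrite ltW//= => /(_ a1).
have -> : a *: y + (1 - a) *: x = a *: (y - x) + x.
  by rewrite scalerBl scale1r scalerBr addrA addrAC.
rewrite -/N => h.
rewrite [_ *: _]mulrC ler_pdivrMr//.
by lra.
Unshelve. all: by end_near. Qed.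

(** Multiply the tangent bound by [2 * mu] and complete the square in
    [gradient f x + mu *: (y - x)]. *)
Lemma polyak_lojasiewicz (R : realType) (d : nat) (mu : R)
    (f : 'rV[R]_d -> R) (x y : 'rV[R]_d) :
  0 < mu -> strongly_convex mu f -> differentiable f x ->
  2 * mu * (f x - f y) <= enorm (gradient f x) ^+ 2.
Proof.
move=> mu0 cf df.
have h1 := ler_wpM2l (ltW mu0) (strongly_convex_tangent y cf df).
have := sqr_ge0 (enorm (gradient f x + mu *: (y - x))).
rewrite (enormD_sqr (gradient f x)) enormZ_sqr dotrZr => h2.
lra.
Qed.

(** * Measurability of continuous functions of random vectors *)

(** An open set is a countable union of boxes with rational centers and radii [1 / (k + 1)], and the
    preimage of a box is a finite intersection over coordinates. Keeping [S] general serves both the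
    ambient sigma-algebra and the histories. *)
Lemma measurable_fun_continuous_row (R : realType) (n : nat)
    (dS : measure_display) (S : measurableType dS)
    (h : 'rV[R]_n -> R) (Y : S -> 'rV[R]_n) :
  continuous h -> (forall i, measurable_fun setT (fun w => Y w ord0 i)) ->
  measurable_fun setT (h \o Y).
Proof.
move=> ch mY; apply: (measurability _ (RGenOpens.measurableE R)).
move=> _ [_ [a [b ->] <-]]; rewrite setTI comp_preimage.
set U := h @^-1` _.
have oU : open U by move/continuousP : ch; apply; exact: interval_open.
pose rad k : R := k.+1%:R^-1.
have rad_gt0 k : 0 < rad k by rewrite invr_gt0.
pose box (p : 'rV[rat]_n * nat) := [set v : 'rV[R]_n |
  forall i, ball (ratr (p.1 ord0 i) : R) (rad p.2) (v ord0 i)].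
have -> : U = \bigcup_(p in [set p | box p `<=` U]) box p.
  apply/seteqP; split => [v Uv|v [p]]; last exact.
  have /nbhs_ballP[e /= e0 eU] : nbhs v U by exact: open_nbhs_nbhs.
  have e20 : 0 < e / 2 by rewrite divr_gt0.
  have [k ke] : exists k, rad k < e / 2.
    exists (Num.truncn (e / 2)^-1); rewrite /rad invf_plt ?posrE//.
    exact: truncnS_gt.
  have q_ex i : exists q : rat, ball (v ord0 i) (rad k) (ratr q).
    have [q] := @rat_in_itvoo R (v ord0 i - rad k) (v ord0 i + rad k)
      (ltac:(by rewrite ltrBlDr -addrA ltrDl addr_gt0)).
    by rewrite in_itv /= => qv; exists q; rewrite -ball_normE /= ltr_distlC.
  pose q := \row_i sval (cid (q_ex i)) : 'rV[rat]_n.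
  have qv i : ball (v ord0 i) (rad k) (ratr (q ord0 i)).
    by rewrite mxE; case: cid.
  exists (q, k); last by move=> i; exact: ball_sym.
  move=> u /= bu; apply: eU; split=> // i j; rewrite ord1.
  apply: (@le_ball _ _ _ (rad k + rad k)).
    by rewrite [leRHS](splitr e) lerD// ltW.
  exact: ball_triangle (qv j) (bu j).
rewrite bigcup_mkcond preimage_bigcup; apply: countable_bigcupT_measurable.
  exact: countableP.
move=> p; case: ifPn => _; last by rewrite preimage_set0.
have -> : Y @^-1` box p =
    \bigcap_(i in [set: 'I_n])
      (fun w => Y w ord0 i) @^-1` ball (ratr (p.1 ord0 i) : R) (rad p.2).
  by apply/seteqP; split => [w bw i _|w bw i]; [exact: bw|exact: (bw i)].
apply: fin_bigcap_measurable => // i _; rewrite -[X in measurable X]setTI.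
by apply: mY => //; exact: measurable_ball.
Qed.

Lemma smooth_continuous (R : realType) (d : nat) (L : R) (f : 'rV[R]_d -> R) :
  smooth L f -> continuous f.
Proof. by move=> [df _] x; exact: differentiable_continuous. Qed.

Lemma smooth_gradient_continuous (R : realType) (d : nat) (L : R)
    (f : 'rV[R]_d -> R) (i : 'I_d) :
  0 < L -> smooth L f -> continuous (fun x => gradient f x ord0 i).
Proof.
move=> L0 [_ lip] x; apply/(@cvgrPdist_le _ _ _ (nbhs x) (nbhs_filter x)) => e e0.
(* The ball is for the max norm, so the Euclidean norm on it is at most [sqrt d * r <= (d + 1) * r];
   [d + 1] is positive even for [d = 0]. *)
pose r := e / (L * (d%:R + 1)).
have d10 : 0 < d%:R + 1 :> R by rewrite ltr_pwDr.
have r0 : 0 < r by rewrite divr_gt0// mulr_gt0.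
apply/nbhs_ballP; exists r => //= y [_ xy].
have coord : `|gradient f x ord0 i - gradient f y ord0 i|
    <= enorm (gradient f x - gradient f y).
  rewrite -(@ler_pXn2r _ 2)// ?nnegrE ?enorm_ge0//.
  rewrite enorm_sum_sqr real_normK ?num_real// (bigD1 i)//= !mxE lerDl.
  by apply: sumr_ge0 => j _; exact: sqr_ge0.
apply: (le_trans coord); apply: (le_trans (lip x y)).
rewrite -ler_pdivlMl//.
have -> : L^-1 * e = (d%:R + 1) * r.
  by rewrite /r; field; rewrite ?lt0r_neq0.
rewrite -(@ler_pXn2r _ 2)// ?nnegrE ?enorm_ge0//;
  last exact: mulr_ge0 (ltW d10) (ltW r0).
rewrite enorm_sum_sqr exprMn.
apply: (@le_trans _ _ (\sum_(j < d) r ^+ 2)).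
  apply: ler_sum => j _; rewrite !mxE -real_normK ?num_real//.
  have /= := xy ord0 j; rewrite -ball_normE /= => /ltW.
  by rewrite ler_pXn2r ?nnegrE ?(ltW r0).
rewrite sumr_const card_ord -[leLHS]mulr_natl ler_wpM2r ?sqr_ge0//.
have : 0 <= d%:R :> R by [].
nra.
Qed.

(** * Conditioning *)

Lemma measurable_wrtP (R : realType) (T : pointedType) (C : set (set T))
    (Y : T -> R) :
  measurable_wrt <<s C >> Y <->
  measurable_fun [set: g_sigma_algebraType C] (Y : g_sigma_algebraType C -> R).
Proof.
split=> [mY _ B mB|mY B mB]; first by rewrite setTI; exact: mY.
by rewrite -[_ @^-1` _]setTI; exact: mY.
Qed.

Section conditioning.
Context (R : realType) (dT : measure_display) (T : measurableType dT).
Context (P : probability T R) (C : set (set T)).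
Hypothesis sub_measurable : <<s C >> `<=` measurable.

Lemma measurable_wrt_measurable_fun (Y : T -> R) :
  measurable_wrt <<s C >> Y -> measurable_fun setT Y.
Proof. by move=> mY _ B mB; rewrite setTI; apply: sub_measurable; exact: mY. Qed.

Import HBNNSimple.

(** Splitting along the level sets of [s], which lie in the sub-sigma-algebra, reduces a simple
    weight to integrals over its events. The values of [s] are nonnegative; [|y|] makes this visible
    for every [y]. *)
Lemma integral_nnsfunM (s : {nnsfun (g_sigma_algebraType C) >-> R}) (Z : T -> R) :
  measurable_fun setT Z -> (forall w, 0 <= Z w) ->
  (\int[P]_w (s w * Z w)%:E =
   \sum_(y <- finmap.enum_fset (fset_set (range s)))
     `|y|%:E * \int[P]_(w in s @^-1` [set y]) (Z w)%:E)%E.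
Proof.
move=> mZ Z0.
have mA y : measurable (s @^-1` [set y] : set T).
  apply: sub_measurable.
  have := @measurable_funPTI _ _ _ _ s [set y] (measurable_set1 y).
  exact.
have mEZ y : measurable_fun setT (fun w : T => (\1_(s @^-1` [set y]) w * Z w)%:E).
  by apply/measurable_EFinP; apply: measurable_funM.
have ge0 y w : (0 <= (\1_(s @^-1` [set y]) w * Z w)%:E)%E.
  by rewrite lee_fin mulr_ge0.
transitivity (\int[P]_w (\sum_(y <- finmap.enum_fset (fset_set (range s)))
     `|y|%:E * (\1_(s @^-1` [set y]) w * Z w)%:E))%E.
  apply: eq_integral => w _.
  rewrite (fimfunE s) fsbig_finite//= mulr_suml -sumEFin.
  apply: eq_big_seq => y; rewrite in_fset_set// inE => -[w' _ <-].
  by rewrite -EFinM ger0_norm// mulrA.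
rewrite ge0_integral_sum//; last 2 first.
  by move=> y; apply: measurable_funeM; exact: mEZ.
  by move=> y w _; rewrite mule_ge0// lee_fin.
apply: eq_bigr => y _.
rewrite ge0_integralZl_EFin//; congr (_ * _)%E.
rewrite [RHS]integral_mkcond; apply: eq_integral => w _.
rewrite patchE indicE; set b := (X in (X%:R * _)%:E).
set b' := (X in if X then _ else _).
have -> : b = b' by [].
by case: b'; rewrite ?mul1r ?mul0r.
Qed.

(** Pull-out property in inequality form: true for simple weights by [integral_nnsfunM], then for
    [W] by monotone convergence from below. Working in the extended reals allows infinite
    integrals. *)
Lemma le_integral_mul_wrt (Z1 Z2 W : T -> R) :
  measurable_fun setT Z1 -> measurable_fun setT Z2 ->
  (forall w, 0 <= Z1 w) -> (forall w, 0 <= Z2 w) ->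
  measurable_wrt <<s C >> W -> (forall w, 0 <= W w) ->
  (forall A, <<s C >> A ->
    \int[P]_(w in A) (Z1 w)%:E <= \int[P]_(w in A) (Z2 w)%:E)%E ->
  (\int[P]_w (W w * Z1 w)%:E <= \int[P]_w (W w * Z2 w)%:E)%E.
Proof.
move=> mZ1 mZ2 Z10 Z20 /measurable_wrtP mW W0 leZ.
have mEW : measurable_fun [set: g_sigma_algebraType C]
   (EFin \o (W : g_sigma_algebraType C -> R)) by exact/measurable_EFinP.
pose s := nnsfun_approx (measurableT : measurable [set: g_sigma_algebraType C]) mEW.
have EW0 (w : g_sigma_algebraType C) : setT w -> (0 <= (EFin \o W) w)%E.
  by rewrite lee_fin.
have s_cvg w := @cvg_nnsfun_approx _ _ _ _ measurableT _ mEW EW0 w Logic.I.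
have s_nd w : nondecreasing_seq (fun n => s n w).
  by move=> m n mn; apply/lefP/nd_nnsfun_approx.
have s_le n w : s n w <= W w.
  rewrite -lee_fin /s nnsfun_approxE.
  exact: (@le_approx _ _ _ _ _ n w EW0).
have ms n : measurable_fun setT (s n : T -> R).
  apply: measurable_wrt_measurable_fun; apply/measurable_wrtP.
  exact: measurable_funPT.
have mono (Z : T -> R) : (forall w, 0 <= Z w) -> forall w,
    nondecreasing_seq (fun n => (s n w * Z w)%:E).
  by move=> Z0 w m n mn; rewrite lee_fin ler_wpM2r// s_nd.
have -> : (\int[P]_w (W w * Z1 w)%:E)%E =
    limn (fun n => \int[P]_w (s n w * Z1 w)%:E)%E.
  rewrite -monotone_convergence//.
  - apply: eq_integral => w _; apply/esym/cvg_lim => //.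
    have -> : (fun n => (s n w * Z1 w)%:E) =
              (fun n => (EFin \o (fun n => s n w)) n * (Z1 w)%:E)%E.
      by apply/funext => n; rewrite EFinM.
    by rewrite EFinM; apply: cvgeZr => //; exact: s_cvg.
  - by move=> n; apply/measurable_EFinP/measurable_funM.
  - by move=> n w _; rewrite lee_fin mulr_ge0.
  - by move=> w _; exact: mono.
apply: lime_le.
  apply: ereal_nondecreasing_is_cvgn => m n mn; apply: ge0_le_integral => //.
  - by move=> w _; rewrite lee_fin mulr_ge0.
  - by apply/measurable_EFinP/measurable_funM.
  - by apply/measurable_EFinP/measurable_funM.
  - by move=> w _; exact: mono.
apply: nearW => n; apply: (@le_trans _ _ (\int[P]_w (s n w * Z2 w)%:E)%E).
  rewrite !integral_nnsfunM//; apply: lee_sum => y _.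
  rewrite lee_wpmul2l//; apply: leZ.
  exact: (@measurable_funPTI _ _ _ _ (s n) [set y] (measurable_set1 y)).
apply: ge0_le_integral => //.
- by move=> w _; rewrite lee_fin mulr_ge0.
- by apply/measurable_EFinP/measurable_funM.
- apply/measurable_EFinP/measurable_funM => //.
  by apply: measurable_wrt_measurable_fun; exact/measurable_wrtP.
- by move=> w _; rewrite lee_fin ler_wpM2r.
Qed.

Lemma condexp_le_integral (Z W : T -> R) (c : R) :
  condexp_le P <<s C >> Z c -> 0 <= c -> (forall w, 0 <= Z w) ->
  measurable_wrt <<s C >> W -> (forall w, 0 <= W w) ->
  (\int[P]_w (W w * Z w)%:E <= \int[P]_w (W w * c)%:E)%E.
Proof.
move=> [Y [iZ iY mY YZ] Yc] c0 Z0 mW W0.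
have mZ : measurable_fun setT Z by apply/measurable_EFinP; exact: measurable_int iZ.
apply: le_integral_mul_wrt => // A CA; rewrite -YZ//.
have mA := sub_measurable CA.
have mEY : measurable_fun A (EFin \o Y).
  by apply: measurable_funTS; exact: measurable_int iY.
(* The version [Y] may be negative somewhere; its positive part is still at most [c] almost surely,
   as [0 <= c]. *)
apply: (@le_trans _ _ (\int[P]_(w in A) (EFin \o Y)^\+ w)%E).
  apply: le_integral => //.
  - exact: integrableS iY.
  - by apply: integrable_funepos => //; exact: integrableS iY.
  - by move=> w _; rewrite funeposE le_max lexx.
apply: ae_ge0_le_integral => //.
- exact: measurable_funepos.
- by apply: filterS Yc => w Ywc _; rewrite funeposE ge_max !lee_fin Ywc.
Qed.

(** The positive and negative parts of [D] have equal integrals over every event of the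
    sub-sigma-algebra, so [le_integral_mul_wrt] in both directions equates their integrals against a
    nonnegative weight. *)
Lemma centered_integral (D W : T -> R) (K : R) :
  P.-integrable setT (EFin \o D) ->
  (forall A, <<s C >> A -> \int[P]_(w in A) (D w)%:E = 0)%E ->
  measurable_wrt <<s C >> W -> (forall w, `|W w| <= K) ->
  P.-integrable setT (EFin \o (fun w => W w * D w)) /\
  (\int[P]_w (W w * D w)%:E = 0)%E.
Proof.
move=> iD D0 mW WK.
have mWT := measurable_wrt_measurable_fun mW.
have K0 w : 0 <= W w + K by have := WK w; rewrite ler_norml => /andP[*]; lra.
have bdd (V : T -> R) M : measurable_fun setT V -> (forall w, `|V w| <= M) ->
    forall D' : T -> R, P.-integrable setT (EFin \o D') ->
    P.-integrable setT (EFin \o (fun w => V w * D' w)).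
  move=> mV VM D' iD'.
  have : P.-integrable setT ((EFin \o V) \* (EFin \o D'))%E.
    apply: integrableMr => //; exists M; split; first exact: num_real.
    by move=> x Mx w _; exact: le_trans (VM w) (ltW Mx).
  by apply: eq_integrable => // w _; rewrite /= EFinM.
have iWD := bdd W K mWT WK D iD.
split=> //.
have mD : measurable_fun setT D by apply/measurable_EFinP; exact: measurable_int iD.
pose Dp w := Num.max (D w) 0; pose Dn w := Num.max (- D w) 0.
have DpnE w : D w = Dp w - Dn w.
  have [h|h] := leP 0 (D w); rewrite /Dp /Dn.
    by rewrite max_l// max_r ?oppr_le0// subr0.
  by rewrite max_r ?ltW// max_l ?oppr_ge0 ?ltW// sub0r opprK.
have iDp : P.-integrable setT (EFin \o Dp).
  have := integrable_funepos measurableT iD.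
  by apply: eq_integrable => // w _; rewrite funeposE /= EFin_max.
have iDn : P.-integrable setT (EFin \o Dn).
  have := integrable_funeneg measurableT iD.
  by apply: eq_integrable => // w _; rewrite funenegE /= EFin_max.
have mDp : measurable_fun setT Dp by apply/measurable_EFinP; exact: measurable_int iDp.
have mDn : measurable_fun setT Dn by apply/measurable_EFinP; exact: measurable_int iDn.
have Dp0 w : 0 <= Dp w by rewrite le_max lexx orbT.
have Dn0 w : 0 <= Dn w by rewrite le_max lexx orbT.
have Dpn A : <<s C >> A ->
    (\int[P]_(w in A) (Dp w)%:E = \int[P]_(w in A) (Dn w)%:E)%E.
  move=> CA; have mA := sub_measurable CA.
  have jDp : P.-integrable A (EFin \o Dp) by exact: integrableS iDp.
  have jDn : P.-integrable A (EFin \o Dn) by exact: integrableS iDn.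
  have := D0 A CA.
  under eq_integral do rewrite DpnE EFinB.
  rewrite integralB_EFin// => /eqP; rewrite sube_eq ?add0e; first by move/eqP.
    exact: integrable_fin_num.
  by rewrite fin_num_adde_defl//; exact: integrable_fin_num.
(* Shifting by [K] makes the weight nonnegative; the shift costs [K] times the integral of [D],
   which is 0. *)
pose V w := W w + K.
have mV : measurable_wrt <<s C >> V.
  apply/measurable_wrtP; apply: measurable_funD => //; exact/measurable_wrtP.
have VK w : `|V w| <= K + K.
  rewrite ger0_norm ?K0// lerD2r; exact: le_trans (ler_norm _) (WK w).
have mVT := measurable_wrt_measurable_fun mV.
have iVDp := bdd V _ mVT VK Dp iDp.
have iVDn := bdd V _ mVT VK Dn iDn.
have VD0 : (\int[P]_w (V w * Dp w)%:E = \int[P]_w (V w * Dn w)%:E)%E.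
  apply/eqP; rewrite eq_le; apply/andP; split;
    by apply: le_integral_mul_wrt => // A CA; rewrite Dpn.
have E : (\int[P]_w (W w * D w)%:E =
    \int[P]_w ((V w * Dp w)%:E - (V w * Dn w)%:E) - K%:E * \int[P]_w (D w)%:E)%E.
  have iVD : P.-integrable setT (EFin \o (fun w => V w * D w)) by exact: bdd VK _ iD.
  rewrite -integralZl//.
  transitivity (\int[P]_w ((V w * D w)%:E - (K * D w)%:E))%E.
    by apply: eq_integral => w _; rewrite -EFinB /V; congr EFin; ring.
  rewrite integralB_EFin//; last first.
    have := integrableZl measurableT K iD.
    by apply: eq_integrable => // w _.
  congr (_ - _)%E; apply: eq_integral => w _; rewrite DpnE -?EFinB; congr EFin; ring.
rewrite E D0; last exact: (@measurableT _ (g_sigma_algebraType C)).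
rewrite mule0 sube0 integralB_EFin// VD0 subee//.
exact: integrable_fin_num.
Qed.

Lemma condexp_eq_integral (Z V W : T -> R) (K : R) :
  condexp_eq P <<s C >> Z V -> measurable_wrt <<s C >> V ->
  measurable_wrt <<s C >> W -> (forall w, `|W w| <= K) ->
  P.-integrable setT (EFin \o (fun w => W w * (Z w - V w))) /\
  (\int[P]_w (W w * (Z w - V w))%:E = 0)%E.
Proof.
move=> [Y [iZ iY mY YZ] YV] mV mW WK.
have mVT := measurable_wrt_measurable_fun mV.
have mYT := measurable_wrt_measurable_fun mY.
have iV : P.-integrable setT (EFin \o V).
  apply/integrableP; split; first exact/measurable_EFinP.
  have /integrableP[_] := iY; congr (_ < _)%E.
  apply: ae_eq_integral => //.
  - by apply: measurableT_comp => //; exact/measurable_EFinP.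
  - by apply: measurableT_comp => //; exact/measurable_EFinP.
  - by apply: filterS YV => w /= -> _.
apply: (@centered_integral _ _ K) => //.
  have := integrableB measurableT iZ iV.
  by apply: eq_integrable => // w _; rewrite /= EFinB.
move=> A CA; have mA := sub_measurable CA.
have iZA : P.-integrable A (EFin \o Z) by exact: integrableS iZ.
have iVA : P.-integrable A (EFin \o V) by exact: integrableS iV.
under eq_integral do rewrite EFinB.
rewrite integralB_EFin// -YZ//.
have -> : (\int[P]_(w in A) (Y w)%:E = \int[P]_(w in A) (V w)%:E)%E.
  apply: ae_eq_integral => //.
  - by apply: measurable_funTS; exact/measurable_EFinP.
  - by apply: measurable_funTS; exact/measurable_EFinP.
  - by apply: filterS YV => w /= -> _.
by rewrite subee//; exact: integrable_fin_num.
Qed.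

End conditioning.

(** * One step of stochastic gradient descent *)

Lemma measurable_fun_step_if (R : realType) (h1 h2 : R -> R) :
  measurable_fun setT h1 -> measurable_fun setT h2 ->
  measurable_fun setT (fun s : R => if s <= 4 then h1 s else h2 s).
Proof.
move=> m1 m2; apply: measurable_fun_ifT => //.
exact: measurable_fun_ler.
Qed.

Lemma measurable_fun_expRZ (R : realType) (a : R) :
  measurable_fun setT (fun s : R => expR (s * a)).
Proof.
apply: (measurableT_comp (@measurable_expR R)).
exact: measurable_funM.
Qed.

Lemma measurable_fun_expRNZ (R : realType) (a : R) :
  measurable_fun setT (fun s : R => expR (- s * a)).
Proof.
apply: (measurableT_comp (@measurable_expR R)).
by apply: measurable_funM => //; exact: oppr_measurable.
Qed.

Lemma measurable_step_cst (R : realType) (c : R) : measurable_fun setT (step_cst c).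
Proof.
apply: measurable_funD.
  apply: measurable_funM.
    by apply: measurable_funM => //; exact: measurable_fun_expRNZ.
  apply: measurable_fun_step_if => //.
  by apply: measurable_funB => //; exact: measurable_funM.
do 2 apply: measurable_funM => //.
exact: measurable_fun_expRNZ.
Qed.

Lemma measurable_step_exp (R : realType) (c : R) : measurable_fun setT (step_exp c).
Proof.
apply: measurable_funD.
  apply: measurable_funM.
    by apply: measurable_funM => //; exact: measurable_fun_expRNZ.
  apply: measurable_fun_step_if; first exact: measurable_funM.
  exact: measurable_fun_expRZ.
do 2 apply: measurable_funM => //.
exact: measurable_fun_expRNZ.
Qed.

Lemma measurable_step_lin (R : realType) (c : R) : measurable_fun setT (step_lin c).
Proof.
apply: measurable_fun_step_if => //.
do 2 apply: measurable_funM => //.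
exact: measurable_fun_expRNZ.
Qed.

Lemma step_lin_abs_le (R : realType) (c s : R) : 0 <= c <= 1 -> 0 <= s ->
  `|step_lin c s| <= 1 / 4.
Proof.
move=> /andP[c0 c1] s0; rewrite /step_lin; case: ifPn => _; last by rewrite normr0; lra.
have e1 : expR (- s / 4) <= 1 by rewrite expR_le1; lra.
have e0 := expR_ge0 (- s / 4).
rewrite ler_norml; apply/andP; split; nra.
Qed.

(** A pathwise bound: write [v] as gradient plus noise in the descent lemma; [t * eta = 1 / 4] turns
    the exponent into the one of [expR_step_le]. *)
Lemma sgd_step_le (R : realType) (d : nat) (L fstar eta t : R)
    (f : 'rV[R]_d -> R) (x v : 'rV[R]_d) :
  smooth L f -> 0 < L -> 0 < eta -> L * eta <= 1 -> 0 < t -> t * eta = 1 / 4 ->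
  expR (t * (f (x - eta *: v) - fstar)) <=
    expR (t * (f x - fstar)) *
    (step_cst (L * eta) (enorm (gradient f x) ^+ 2)
     + step_exp (L * eta) (enorm (gradient f x) ^+ 2)
       * expR (1 / 4 * enorm (v - gradient f x) ^+ 2)
     + step_lin (L * eta) (enorm (gradient f x) ^+ 2)
       * dotr (gradient f x) (v - gradient f x)).
Proof.
move=> sf L0 eta0 c1 t0 teta.
set s := enorm (gradient f x) ^+ 2; set c := L * eta.
set dl := v - gradient f x; set p := dotr _ dl; set r := enorm dl ^+ 2.
have c01 : 0 <= c <= 1 by rewrite mulr_ge0 ?(ltW L0) ?(ltW eta0).
have := smooth_descent x (- eta *: v) sf.
have vE : v = gradient f x + dl by rewrite /dl subrKC.
rewrite dotrZr enormZ_sqr {2 3}vE dotrDr (enormD_sqr (gradient f x)).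
rewrite -enorm_sqr -/p -/r -/s scaleNr => desc.
have := expR_step_le c01 (sqr_ge0 _ : 0 <= s) (sqr_ge0 _ : 0 <= r)
  (dotr_sqr_le (gradient f x) dl).
have -> : r / 4 = 1 / 4 * r by rewrite mulrC mul1r.
move=> /(ler_wpM2l (expR_ge0 (t * (f x - fstar)))); apply: le_trans.
rewrite -expRD ler_expR.
have := ler_wpM2l (ltW t0) desc.
have -> : t * (f x + - eta * (s + p) + L / 2 * ((- eta) ^+ 2 * (s + 2 * p + r))) =
  t * f x - (t * eta) * (s + p) + (t * eta) * c / 2 * (s + 2 * p + r).
  by rewrite /c; field.
by rewrite teta -/p; lra.
Qed.

Section sgd_step.
Context (R : realType) (dT : measure_display) (T : measurableType dT).
Context (P : probability T R) (C : set (set T)).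
Hypothesis sub_measurable : <<s C >> `<=` measurable.
Context (d : nat) (f : 'rV[R]_d -> R) (mu L fstar : R) (xstar : 'rV[R]_d).
Hypotheses (mu_gt0 : 0 < mu) (L_gt0 : 0 < L).
Hypotheses (convf : strongly_convex mu f) (smoothf : smooth L f).
Hypothesis fstarE : f xstar = fstar.
Context (X V : T -> 'rV[R]_d).
Hypothesis mX : forall i, measurable_wrt <<s C >> (fun w => X w ord0 i).
Hypothesis mV : forall i, measurable_fun setT (fun w => V w ord0 i).
Hypothesis unbiased : forall i,
  condexp_eq P <<s C >> (fun w => V w ord0 i) (fun w => gradient f (X w) ord0 i).
Hypothesis subgauss : condexp_le P <<s C >>
  (fun w => expR (1 / 4 * enorm (V w - gradient f (X w)) ^+ 2)) (3 / 2).
Context (eta t : R).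
Hypotheses (eta_gt0 : 0 < eta) (Leta : L * eta <= 1).
Hypotheses (t_gt0 : 0 < t) (teta : t * eta = 1 / 4).

Let c := L * eta.
Let s (w : T) := enorm (gradient f (X w)) ^+ 2.
Let W (w : T) := expR (t * (f (X w) - fstar)).
Let Z (w : T) := expR (1 / 4 * enorm (V w - gradient f (X w)) ^+ 2).
Let S := g_sigma_algebraType C.

Let c01 : 0 <= c <= 1. Proof. by rewrite mulr_ge0 ?(ltW L_gt0) ?(ltW eta_gt0). Qed.

Let mXS i : measurable_fun [set: S] (fun w : S => X w ord0 i).
Proof. exact/measurable_wrtP. Qed.

Let mgrad i : measurable_fun [set: S] (fun w : S => gradient f (X w) ord0 i).
Proof.
exact: (@measurable_fun_continuous_row _ _ _ S (fun x => gradient f x ord0 i) X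
  (smooth_gradient_continuous (i := i) L_gt0 smoothf) mXS).
Qed.

Let mf : measurable_fun [set: S] (fun w : S => f (X w)).
Proof.
exact: (@measurable_fun_continuous_row _ _ _ S f X (smooth_continuous smoothf) mXS).
Qed.

Let ms : measurable_fun [set: S] (s : S -> R).
Proof.
rewrite /s; under eq_fun do rewrite enorm_sum_sqr.
by apply: measurable_sum => i; exact: measurable_funX.
Qed.

Let mW : measurable_fun [set: S] (W : S -> R).
Proof.
apply: (measurableT_comp (@measurable_expR R)).
by apply: measurable_funM => //; exact: measurable_funB.
Qed.

Let toT (Y : T -> R) : measurable_fun [set: S] (Y : S -> R) -> measurable_fun setT Y.
Proof.
move=> mY; apply: (measurable_wrt_measurable_fun sub_measurable).
exact: (measurable_wrtP C Y).2 mY.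
Qed.

Let mZ : measurable_fun setT Z.
Proof.
apply: (measurableT_comp (@measurable_expR R)).
apply: measurable_funM => //.
under eq_fun do rewrite enorm_sum_sqr.
apply: measurable_sum => i; apply: measurable_funX.
under eq_fun do rewrite 2!mxE.
apply: measurable_funB; [exact: mV|exact: (toT (mgrad i))].
Qed.

Let gamma i (w : T) := W w * step_lin c (s w) * gradient f (X w) ord0 i.

Let mgamma i : measurable_fun [set: S] (gamma i : S -> R).
Proof.
apply: measurable_funM => //; apply: measurable_funM => //.
exact: (measurableT_comp (measurable_step_lin c)).
Qed.

(** Boundedness is what lets unbiasedness cancel the linear term. [step_lin] vanishes for [s > 4];
    otherwise the gradient has norm at most 2 and, by Polyak-Lojasiewicz, the optimality gap is at
    most [2 / mu]. *)
Let gamma_bound i w : `|gamma i w| <= expR (t * (2 / mu)).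
Proof.
rewrite /gamma; have [s4|s4] := leP (s w) 4; last first.
  by rewrite /step_lin (lt_geF s4) mulr0 mul0r normr0 expR_ge0.
have lin := step_lin_abs_le c01 (sqr_ge0 _ : 0 <= s w).
have grad2 : `|gradient f (X w) ord0 i| <= 2.
  rewrite -(@ler_pXn2r _ 2)// ?nnegrE// real_normK ?num_real//.
  have -> : (2 : R) ^+ 2 = 4 by rewrite expr2; lra.
  apply: le_trans s4; rewrite /s enorm_sum_sqr (bigD1 i)//= lerDl.
  by apply: sumr_ge0 => j _; exact: sqr_ge0.
have Wle : W w <= expR (t * (2 / mu)).
  rewrite ler_expR ler_wpM2l ?(ltW t_gt0)// ler_pdivlMr//.
  have := polyak_lojasiewicz xstar mu_gt0 convf (smoothf.1 (X w)).
  by rewrite fstarE -/(s w); lra.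
rewrite !normrM (ger0_norm (expR_ge0 _)).
rewrite -mulrA -[leRHS]mulr1 ler_pM ?expR_ge0 ?mulr_ge0//.
by apply: (@le_trans _ _ (1 / 4 * 2)); [exact: ler_pM|lra].
Qed.

Lemma sgd_step_integral :
  (\int[P]_w (expR (t * (f (X w - eta *: V w) - fstar)))%:E <=
   \int[P]_w (expR (c / 4 - s w / 16 + t * (f (X w) - fstar)))%:E)%E.
Proof.
(* The pathwise bound reads [a + b * Z + N], with [N] the linear noise term, of mean zero. *)
pose a w := W w * step_cst c (s w).
pose b w := W w * step_exp c (s w).
pose N w := \sum_(i < d) gamma i w * (V w ord0 i - gradient f (X w) ord0 i).
have s0 w : 0 <= s w by exact: sqr_ge0.
have W0 w : 0 <= W w by exact: expR_ge0.
have a0 w : 0 <= a w by rewrite mulr_ge0// step_cst_ge0.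
have b0 w : 0 <= b w by rewrite mulr_ge0// step_exp_ge0.
have Z0 w : 0 <= Z w by exact: expR_ge0.
have ma : measurable_fun setT a.
  apply: toT; apply: measurable_funM => //.
  exact: (measurableT_comp (measurable_step_cst c)).
have mbS : measurable_fun [set: S] (b : S -> R).
  apply: measurable_funM => //.
  exact: (measurableT_comp (measurable_step_exp c)).
have mb : measurable_fun setT b by exact: toT.
have centered i := condexp_eq_integral sub_measurable (unbiased i)
  (iffRL (measurable_wrtP _ _) (mgrad i)) (iffRL (measurable_wrtP _ _) (mgamma i))
  (gamma_bound i).
have iN : P.-integrable setT (EFin \o N).
  have := integrable_sum measurableT (index_enum 'I_d)
    (fun i (_ : true) => (centered i).1).
  by apply: eq_integrable => // w _; rewrite /= -sumEFin.
have N0 : (\int[P]_w (N w)%:E = 0)%E.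
  under eq_integral do rewrite /N -sumEFin.
  rewrite (integral_sum measurableT (fun i => (centered i).1)).
  by rewrite big1// => i _; exact: (centered i).2.
have mW' : measurable_fun setT W by exact: toT.
have ms' : measurable_fun setT s by exact: toT.
have mf' : measurable_fun setT (fun w => f (X w)) by exact: toT.
have le1 : (\int[P]_w (a w + b w * Z w)%:E <=
    \int[P]_w (expR (c / 4 - s w / 16 + t * (f (X w) - fstar)))%:E)%E.
  have le0 : (\int[P]_w (a w + b w * Z w)%:E <=
      \int[P]_w (a w + b w * (3 / 2))%:E)%E.
    under eq_integral do rewrite EFinD.
    under [leRHS]eq_integral do rewrite EFinD.
    rewrite !ge0_integralD//; do ?[by apply/measurable_EFinP => //;
      exact: measurable_funM | by move=> w _; exact: a0 |
      by move=> w _; rewrite lee_fin mulr_ge0].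
    rewrite leeD2l//; apply: (condexp_le_integral sub_measurable subgauss) => //.
    exact: (measurable_wrtP C b).2.
  apply: (le_trans le0).
  apply: ge0_le_integral => //.
  - by move=> w _; rewrite lee_fin addr_ge0// mulr_ge0.
  - by apply/measurable_EFinP; apply: measurable_funD => //; exact: measurable_funM.
  - apply/measurable_EFinP; apply: (measurableT_comp (@measurable_expR R)).
    apply: measurable_funD.
      by apply: measurable_funB => //; exact: measurable_funM.
    by apply: measurable_funM => //; exact: measurable_funB.
  - move=> w _; rewrite lee_fin expRD [leRHS]mulrC /a /b -[W w * _ * _]mulrA -mulrDr.
    rewrite ler_wpM2l//.
    by rewrite (mulrC (step_exp _ _)) step_sum_le.
apply: le_trans le1.
set I := (\int[P]_w (a w + b w * Z w)%:E)%E.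
(* An infinite [I] makes the bound trivial; a finite one makes [a + b * Z] integrable, so that the
   signed [N] can be added under the integral. *)
have [->|Ify] := eqVneq I +oo%E; first by rewrite leey.
have mabZ : measurable_fun setT (fun w => a w + b w * Z w).
  by apply: measurable_funD => //; exact: measurable_funM.
have iabZ : P.-integrable setT (EFin \o (fun w => a w + b w * Z w)).
  apply/integrableP; split; first exact/measurable_EFinP.
  have abZ0 w : 0 <= a w + b w * Z w by rewrite addr_ge0// mulr_ge0.
  under eq_integral do rewrite /= ger0_norm//.
  by rewrite -/I ltey.
have -> : I = (\int[P]_w (a w + b w * Z w + N w)%:E)%E.
  under eq_integral do rewrite EFinD.
  rewrite (integralD_EFin measurableT iabZ iN) /=.
  by rewrite [X in (_ + X)%E]N0 adde0.
apply: ge0_le_integral => //.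
- apply/measurable_EFinP; apply: (measurableT_comp (@measurable_expR R)).
  apply: measurable_funM => //; apply: measurable_funB => //.
  apply: (measurable_fun_continuous_row (smooth_continuous smoothf)) => i.
  under eq_fun do rewrite !mxE.
  apply: measurable_funB; [exact: (toT (mXS i))|exact: measurable_funM].
- apply/measurable_EFinP; apply: measurable_funD => //.
  by apply/measurable_EFinP; exact: measurable_int iN.
- move=> w _; rewrite lee_fin.
  apply: le_trans
    (sgd_step_le fstar (X w) (V w) smoothf L_gt0 eta_gt0 Leta t_gt0 teta) _.
  rewrite -/(s w) -/c -/(Z w) -/(W w).
  have -> : N w = W w * step_lin c (s w) *
      dotr (gradient f (X w)) (V w - gradient f (X w)).
    by rewrite /N /gamma /dotr mulr_sumr; apply: eq_bigr => i _; rewrite !mxE mulrA.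
  by rewrite le_eqVlt; apply/orP; left; apply/eqP; rewrite /a /b; ring.
Qed.

End sgd_step.

(** * The moment generating function along the iterates *)

Lemma condexp_le_trans (R : realType) (dT : measure_display)
    (T : measurableType dT) (P : probability T R) (G : set (set T))
    (Z : T -> R) (c c' : R) :
  c <= c' -> condexp_le P G Z c -> condexp_le P G Z c'.
Proof.
move=> cc' [Y YZ Yc]; exists Y => //.
by apply: filterS Yc => w /le_trans; apply.
Qed.

Section history_theory.
Context (R : realType) (dT dX : measure_display).
Context (T : measurableType dT) (X : measurableType dX) (xi : nat -> T -> X).

Lemma history_measurable (k : nat) :
  (forall i, measurable_fun setT (xi i)) -> history xi k `<=` measurable.
Proof.
move=> mxi; apply: smallest_sub; first exact: sigma_algebra_measurable.
by move=> _ [i _ [B mB <-]]; exact: mxi.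
Qed.

Lemma history_nondecreasing (k : nat) : history xi k `<=` history xi k.+1.
Proof.
apply: sub_sigma_algebra2 => A [i ik iA]; exists i => //.
exact: leq_trans ik (leqnSn k).
Qed.

Lemma measurable_wrt_history_iterate (d : nat) (x v : nat -> T -> 'rV[R]_d)
    (x0 : 'rV[R]_d) (eta : nat -> R) :
  (forall w, x 0%N w = x0) ->
  (forall k w, x k.+1 w = x k w - eta k *: v k w) ->
  (forall k i, measurable_wrt (history xi k.+1) (fun w => v k w ord0 i)) ->
  forall k i, measurable_wrt (history xi k) (fun w => x k w ord0 i).
Proof.
move=> x_0 x_S mv; elim=> [|k IH] i.
  have -> : (fun w => x 0%N w ord0 i) = cst (x0 ord0 i).
    by apply/funext => w; rewrite x_0.
  by apply/measurable_wrtP; exact: measurable_cst.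
have -> : (fun w => x k.+1 w ord0 i) =
    (fun w => x k w ord0 i - eta k * v k w ord0 i).
  by apply/funext => w; rewrite x_S !mxE.
have mx : measurable_wrt (history xi k.+1) (fun w => x k w ord0 i).
  by move=> A mA; apply: history_nondecreasing; exact: IH.
apply/measurable_wrtP; apply: measurable_funB; first exact: (measurable_wrtP _ _).1 mx.
by apply: measurable_funM => //; exact: (measurable_wrtP _ _).1 (mv k i).
Qed.

End history_theory.

(** Markov on the complement: there [expR (t * Y)] exceeds [expR (t * b)], which is
    [expR M / beta]. *)
Lemma expR_markov (R : realType) (dT : measure_display) (T : measurableType dT)
    (P : probability T R) (Y : T -> R) (t b M beta : R) :
  measurable_fun setT Y -> 0 < t -> 0 < beta ->
  (\int[P]_w (expR (t * Y w))%:E <= (expR M)%:E)%E ->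
  t * b = ln (1 / beta) + M ->
  ((1 - beta)%:E <= P [set w | (Y w <= b)%R])%E.
Proof.
move=> mY t0 b0 leM tb.
set A := [set w | Y w <= b].
have mA : measurable A.
  have -> : A = Y @^-1` `]-oo, b] by apply/seteqP; split => w; rewrite /A /= in_itv.
  by rewrite -[_ @^-1` _]setTI; exact: mY.
have mE : measurable_fun setT (fun w => (expR (t * Y w))%:E).
  apply/measurable_EFinP; apply: (measurableT_comp (@measurable_expR R)).
  exact: measurable_funM.
have tail : ((expR (t * b))%:E * P (~` A) <= (expR M)%:E)%E.
  rewrite -integral_cst; last exact: measurableC.
  apply: le_trans leM.
  apply: (@le_trans _ _ (\int[P]_(w in ~` A) (expR (t * Y w))%:E)%E).
    apply: ge0_le_integral => //.
    - exact: measurableC.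
    - by move=> w _; rewrite lee_fin expR_ge0.
    - exact: measurable_funTS.
    - move=> w /negP; rewrite -ltNge => bY.
      by rewrite lee_fin ler_expR ler_pM2l// ltW.
  apply: ge0_subset_integral => //; exact: measurableC.
have PAE : P A = (fine (P A))%:E by rewrite fineK// fin_num_measure.
move: tail; rewrite probability_setC// PAE -EFinB -EFinM !lee_fin.
rewrite tb expRD lnK ?posrE ?divr_gt0// mulrAC -[leRHS]mul1r.
by rewrite ler_pM2r ?expR_gt0// mulrC mulrA mulr1 ler_pdivrMr// mul1r; lra.
Qed.

(** Here [n = k + B - 1]. The bound on [s] removes [2 * mu / 16 * D], leaving
    [mu * (n - 1) / 16 * D], that is, [(n - 1) / n] times the previous exponent. The rest satisfies
    [c / 4 = (L / mu) / (n + 1) <= M / n], so convexity applies with weights [(n - 1) / n] and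
    [1 / n]. *)
Lemma expR_contraction_le (R : realType) (c s D mu L M n : R) :
  0 < mu -> 0 < L -> 2 <= n -> L / mu <= M -> 2 * mu * D <= s ->
  c = L * (4 / (mu * (n + 1))) ->
  expR (c / 4 - s / 16 + mu * (n + 1) / 16 * D) <=
    (n - 1) / n * expR (mu * n / 16 * D) + n^-1 * expR M.
Proof.
move=> mu0 L0 n2 LM Ds cE.
have n0 : 0 < n by lra.
set r := (n - 1) / n.
have rE : 1 - r = n^-1 by rewrite /r; field; rewrite gt_eqF.
have r01 : 0 <= r <= 1.
  rewrite /r divr_ge0 ?(ltW n0)//=; last by lra.
  by rewrite ler_pdivrMr//; lra.
have := expR_convex (mu * n / 16 * D) M r01; rewrite rE.
apply: le_trans; rewrite ler_expR.
have -> : r * (mu * n / 16 * D) = mu * (n - 1) / 16 * D.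
  by rewrite /r; field; rewrite gt_eqF.
have : c / 4 <= n^-1 * M.
  apply: (@le_trans _ _ (n^-1 * (L / mu))); last by rewrite ler_wpM2l// invr_ge0 ltW.
  have -> : c / 4 = (n + 1)^-1 * (L / mu).
    by rewrite cE; field; rewrite !gt_eqF//; lra.
  rewrite ler_wpM2r ?divr_ge0 ?(ltW L0) ?(ltW mu0)//.
  by rewrite lef_pV2 ?posrE//; lra.
by lra.
Qed.

Theorem lemma3 (R : realType) (d : nat)
    (dT dX : measure_display) (T : measurableType dT) (X : measurableType dX)
    (P : probability T R)
    (f : 'rV[R]_d -> R) (mu L fstar : R)
    (hmu : 0 < mu) (hL : 0 < L)
    (hconv : strongly_convex mu f) (hsmooth : smooth L f)
    (hmin : (forall y, fstar <= f y) /\ (exists y, f y = fstar))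
    (B : R) (hB : B = Num.max (4 * L / mu) 3)
    (eta : nat -> R) (heta : forall k, eta k = 4 / (mu * (k%:R + B)))
    (xi : nat -> T -> X) (hxi : forall k, measurable_fun setT (xi k))
    (g : 'rV[R]_d -> X -> 'rV[R]_d)
    (x0 : 'rV[R]_d) (x : nat -> T -> 'rV[R]_d)
    (hx0 : forall w, x 0%N w = x0)
    (hxS : forall k w, x k.+1 w = x k w - eta k *: g (x k w) (xi k w))
    (* g(x_k; xi_k) is a sigma(xi_0, ..., xi_k)-measurable random vector *)
    (hgmeas : forall k (i : 'I_d),
      measurable_wrt (history xi k.+1) (fun w => g (x k w) (xi k w) ord0 i))
    (hunbiased : forall k (i : 'I_d),
      condexp_eq P (history xi k) (fun w => g (x k w) (xi k w) ord0 i)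
        (fun w => gradient f (x k w) ord0 i))
    (hsubgauss : forall k (t : R), 0 < t < 1 / 2 ->
      condexp_le P (history xi k)
        (fun w => expR (t * enorm (g (x k w) (xi k w) - gradient f (x k w)) ^+ 2))
        (1 / Num.sqrt (1 - 2 * t))) :
  forall (k : nat) (beta : R), 0 < beta < 1 ->
    ((1 - beta)%:E <=
      P [set w | (f (x k w) - fstar <=
          (16 * mu * ln (1 / beta) + mu ^+ 2 * (B - 1) * (f x0 - fstar) + 16 * L)
            / (mu ^+ 2 * (k%:R + B - 1)))%R])%E.
Proof.
have B3 : 3 <= B by rewrite hB le_max lexx orbT.
(* This gives [L * eta k <= 1], while [B3] gives [2 <= n] below. *)
have BL : 4 * L <= mu * B.
  by rewrite [leRHS]mulrC -ler_pdivrMr// hB le_max lexx.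
have [xs fxs] := hmin.2.
have mhist k : history xi k `<=` measurable by exact: history_measurable.
have mx := measurable_wrt_history_iterate hx0 hxS hgmeas.
have mxT k i : measurable_fun setT (fun w => x k w ord0 i).
  exact: (measurable_wrt_measurable_fun (mhist k) (mx k i)).
have mgT k i : measurable_fun setT (fun w => g (x k w) (xi k w) ord0 i).
  exact: (measurable_wrt_measurable_fun (mhist k.+1) (hgmeas k i)).
have mfx k : measurable_fun setT (fun w => f (x k w) - fstar).
  apply: measurable_funB => //.
  exact: (measurable_fun_continuous_row (smooth_continuous hsmooth) (mxT k)).
(* At [t = 1 / 4] the moment bound is [sqrt 2], rounded up to [3 / 2]. *)
have subgauss k : condexp_le P (history xi k)
    (fun w => expR (1 / 4 * enorm (g (x k w) (xi k w) - gradient f (x k w)) ^+ 2))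
    (3 / 2).
  apply: condexp_le_trans (hsubgauss k (1 / 4) _); last by lra.
  have -> : 1 - 2 * (1 / 4) = 2^-1 :> R by field.
  have sq : 2 / 3 <= Num.sqrt (2^-1 : R).
    have -> : 2 / 3 = Num.sqrt ((2 / 3) ^+ 2) :> R by rewrite sqrtr_sqr ger0_norm.
    by rewrite ler_wsqrtr//; lra.
  by rewrite ler_pdivrMr; lra.
pose t k := mu * (k%:R + B - 1) / 16.
(* The first summand covers the starting point, the second ensures [L / mu <= M] for the contraction
   step. *)
pose M := t 0%N * (f x0 - fstar) + L / mu.
have LM : L / mu <= M.
  rewrite lerDr mulr_ge0 ?subr_ge0 ?hmin.1// /t divr_ge0// mulr_ge0 ?(ltW hmu)//.
  by lra.
have int_cst (r : R) : (\int[P]_w r%:E = r%:E)%E.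
  by rewrite integral_cst// [X in (_ * X)%E]probability_setT mule1.
have mgf k : (\int[P]_w (expR (t k * (f (x k w) - fstar)))%:E <= (expR M)%:E)%E.
  elim: k => [|k IH].
    under eq_integral do rewrite hx0.
    rewrite int_cst lee_fin ler_expR.
    by rewrite /M lerDl divr_ge0 ?(ltW hL) ?(ltW hmu).
  have k0 : 0 <= k%:R :> R by [].
  pose n := k%:R + B - 1.
  have n2 : 2 <= n by rewrite /n; lra.
  have tSE : t k.+1 = mu * (n + 1) / 16.
    by rewrite /t /n -natr1; congr (_ * _ / _); ring.
  have etaE : eta k = 4 / (mu * (n + 1)) by rewrite heta /n subrK.
  have mun : 0 < mu * (n + 1) by rewrite mulr_gt0//; lra.
  have := @sgd_step_integral R dT T P _ (mhist k) d f mu L fstar xs hmu hL hconv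
    hsmooth fxs (x k) (fun w => g (x k w) (xi k w)) (mx k) (mgT k) (hunbiased k)
    (subgauss k) (eta k) (t k.+1).
  have -> : 0 < eta k by rewrite etaE divr_gt0.
  have -> : L * eta k <= 1.
    rewrite etaE mulrA ler_pdivrMr// mul1r.
    have : 0 <= mu * k%:R by rewrite mulr_ge0// ltW.
    by rewrite /n; nra.
  have -> : 0 < t k.+1 by rewrite tSE divr_gt0.
  have -> : t k.+1 * eta k = 1 / 4.
    by rewrite tSE etaE; field; rewrite !gt_eqF//; lra.
  move=> /(_ isT isT isT erefl) step.
  under eq_integral do rewrite hxS.
  apply: (le_trans step).
  pose r := (n - 1) / n.
  have r0 : 0 <= r by rewrite divr_ge0//; lra.
  have n0 : 0 <= n^-1 by rewrite invr_ge0; lra.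
  have mstep : measurable_fun setT (fun w => (expR (t k * (f (x k w) - fstar)))%:E).
    apply/measurable_EFinP; apply: (measurableT_comp (@measurable_expR R)).
    exact: measurable_funM.
  apply: (@le_trans _ _ (\int[P]_w
      (r%:E * (expR (t k * (f (x k w) - fstar)))%:E + (n^-1 * expR M)%:E))%E).
    apply: ge0_le_integral => //.
    - apply/measurable_EFinP; apply: (measurableT_comp (@measurable_expR R)).
      apply: measurable_funD; last exact: measurable_funM.
      apply: measurable_funB => //; apply: measurable_funM => //.
      under eq_fun do rewrite enorm_sum_sqr.
      apply: measurable_sum => i; apply: measurable_funX.
      exact: (measurable_fun_continuous_row
        (smooth_gradient_continuous (i := i) hL hsmooth) (mxT k)).
    - by apply: emeasurable_funD => //; exact: measurable_funeM.
    - move=> w _; rewrite -EFinM -EFinD lee_fin tSE.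
      apply: (expR_contraction_le hmu hL n2 LM); last by rewrite etaE.
      by have := polyak_lojasiewicz xs hmu hconv (hsmooth.1 (x k w)); rewrite fxs.
  have nr : r + n^-1 = 1 by rewrite /r; field; rewrite gt_eqF//; lra.
  rewrite ge0_integralD//; do ?[exact: measurable_funeM |
    by move=> w _; rewrite -?EFinM lee_fin mulr_ge0 ?expR_ge0].
  rewrite int_cst ge0_integralZl_EFin//.
  (* The two weights sum to 1, so the bound [expR M] reproduces itself. *)
  have {2}-> : expR M = r * expR M + n^-1 * expR M by rewrite -mulrDl nr mul1r.
  by rewrite EFinD (EFinM r) leeD2r// lee_wpmul2l// lee_fin.
move=> k beta /andP[b0 b1].
have k0 : 0 <= k%:R :> R by [].
apply: (expR_markov (mfx k) (_ : 0 < t k) b0 (mgf k)).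
  by rewrite divr_gt0// mulr_gt0//; lra.
(* The threshold of the theorem is exactly [(ln (1 / beta) + M) / t k]. *)
rewrite /M /t add0r; field; rewrite !gt_eqF//; lra.
Qed.
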